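(* Let $\mathfrak{A}$ be a unital Banach algebra and let $n\ge 2$. Suppose that $R=[A_1\ \dots\ A_n]\in\mathcal{R}_n(\mathfrak{A})$ and $C=[C_1\ \dots\ C_n]^t\in\mathcal{C}_n(\mathfrak{A})$ satisfy $RC=1$. Then the following are equivalent: (i) There is an invertible matrix $W\in\mathfrak{M}_n(\mathfrak{A})$ with first row $R$. (ii) There is an invertible matrix $W\in\mathfrak{M}_n(\mathfrak{A})$ with first column $C$. (iii) There is an invertible matrix $W\in\mathfrak{M}_n(\mathfrak{A})$ with first row $R$ such that the first column of $W^{-1}$ is $C$. (iv) The idempotent $CR$ is similar in $\mathfrak{M}_n(\mathfrak{A})$ to $E_{11}$.
   Context: $\mathcal{R}_n(\mathfrak{A})$ is the set of $1\times n$ matrices (rows) with entries in $\mathfrak{A}$, $\mathcal{C}_n(\mathfrak{A})$ the set of $n\times 1$ matrices (columns) with entries in $\mathfrak{A}$, and $\mathfrak{M}_n(\mathfrak{A})$ the algebra of $n\times n$ matrices over $\mathfrak{A}$. $E_{ij}$ denotes the standard matrix units of $\mathfrak{M}_n(\mathfrak{A})$. Two elements $P,Q$ of $\mathfrak{M}_n(\mathfrak{A})$ are similar in $\mathfrak{M}_n(\mathfrak{A})$ if $WPW^{-1}=Q$ for some invertible $W\in\mathfrak{M}_n(\mathfrak{A})$. *)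

(* Defs.v *)
From HB Require Import structures.
From mathcomp Require Import all_boot all_order all_algebra.
From mathcomp Require Import all_classical all_reals all_analysis.

Set Implicit Arguments.
Unset Strict Implicit.
Unset Printing Implicit Defensive.

Import Order.TTheory GRing.Theory Num.Theory.
Import numFieldNormedType.Exports.
Local Open Scope ring_scope.

(** Unital Banach algebras, not assumed commutative.  The scalars are any
    [numFieldType], as for [completeNormedModType], so that real and complex
    Banach algebras are both covered.

    [Num.NumDomain] is already a join of the ring and norm structures, so HB
    rejects a new structure inheriting from both [CompleteNormedModule] and
    [GRing.Algebra].  The product is therefore a field of the mixin, and the
    [algType] structure is derived from it below; in [A : banachAlgType K],
    [x * y] and [1] unfold to [bmul x y] and [bone]. *)
HB.mixin Record CompleteNormedModule_isBanachAlgebra (K : numFieldType) A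
    & CompleteNormedModule K A := {
  bone : A ;
  bmul : A -> A -> A ;
  bmulA : associative bmul ;
  bmul1l : left_id bone bmul ;
  bmul1r : right_id bone bmul ;
  bmulDl : left_distributive bmul +%R ;
  bmulDr : right_distributive bmul +%R ;
  bscalel : forall (a : K) (x y : A), a *: bmul x y = bmul (a *: x) y ;
  bscaler : forall (a : K) (x y : A), a *: bmul x y = bmul x (a *: y) ;
  bnormM : forall x y : A, `|bmul x y| <= `|x| * `|y| ;
  bnorm1 : `|bone| = 1
}.

#[short(type="banachAlgType")]
HB.structure Definition BanachAlgebra (K : numFieldType) :=
  {A of CompleteNormedModule K A & CompleteNormedModule_isBanachAlgebra K A}.

Section BanachAlgebraIsAlgebra.
Variables (K : numFieldType) (A : banachAlgType K).

Let bone_neq0 : (bone : A) != 0.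
Proof. by rewrite -normr_eq0 bnorm1 oner_eq0. Qed.

HB.instance Definition _ := GRing.Zmodule_isNzRing.Build (BanachAlgebra.sort A)
  (@bmulA K A) (@bmul1l K A) (@bmul1r K A) (@bmulDl K A) (@bmulDr K A)
  bone_neq0.
HB.instance Definition _ :=
  GRing.Lmodule_isLalgebra.Build K (BanachAlgebra.sort A) (@bscalel K A).
HB.instance Definition _ :=
  GRing.Lalgebra_isAlgebra.Build K (BanachAlgebra.sort A) (@bscaler K A).

End BanachAlgebraIsAlgebra.

(** [unitmx] and [invmx] are only available over commutative rings, whence
    the explicit two-sided inverses below. *)
Section MatricesOverRing.
Variables (A : nzRingType) (n : nat).
Implicit Types P Q W V : 'M[A]_n.

Definition inverse_of_mx W V : Prop := W *m V = 1%:M /\ V *m W = 1%:M.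

Definition invertible_mx W : Prop := exists V, inverse_of_mx W V.

Definition similar_mx P Q : Prop :=
  exists W V, inverse_of_mx W V /\ W *m P *m V = Q.

End MatricesOverRing.

Definition first_ord (n : nat) (hn : (2 <= n)%N) : 'I_n := Ordinal (ltnW hn).

(* Main.v *)
Require Import Defs.
From HB Require Import structures.
From mathcomp Require Import all_boot all_order all_algebra.
From mathcomp Require Import all_classical all_reals all_analysis.

(** With [e], [f] the first standard column and row, [E_11 = e f] and [f e = 1].
    If [f W = R], then [X = W C] satisfies [f X = R C = 1], so the transvection
    [1 - (X - e) f] fixes [f] on the left and sends [X] to [e]; composing it
    with [W] keeps the first row and makes [C] the first column of the inverse.
    Dually for columns.  If [W (C R) W^-1 = e f], then [W C = e a] and
    [R W^-1 = b f] with [a], [b] mutually inverse scalars, so scaling the first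
    row of [W] by [b] gives [R]. *)

Set Implicit Arguments.
Unset Strict Implicit.
Unset Printing Implicit Defensive.

Import Order.TTheory GRing.Theory Num.Theory.
Import numFieldNormedType.Exports.
Local Open Scope ring_scope.

Section MatrixCompletion.
Variables (A : nzRingType) (n : nat).
Implicit Types (W V : 'M[A]_n) (R : 'rV[A]_n) (C : 'cV[A]_n).

Lemma inverse_of_mxM W1 V1 W2 V2 :
  inverse_of_mx W1 V1 -> inverse_of_mx W2 V2 ->
  inverse_of_mx (W1 *m W2) (V2 *m V1).
Proof.
move=> [W1V1 V1W1] [W2V2 V2W2]; split.
  by rewrite mulmxA -(mulmxA W1) W2V2 mulmx1.
by rewrite mulmxA -(mulmxA V2) V1W1 mulmx1.
Qed.

Lemma inverse_of_mx_sym W V : inverse_of_mx W V -> inverse_of_mx V W.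
Proof. by case. Qed.

(** Since [R *m C = 0], the matrix [C *m R] squares to zero. *)
Lemma inverse_transvection C R :
  R *m C = 0 -> inverse_of_mx (1%:M - C *m R) (1%:M + C *m R).
Proof.
move=> RC0; have sq0 : C *m R *m (C *m R) = 0.
  by rewrite mulmxA -(mulmxA C) RC0 mulmx0 mul0mx.
split.
  by rewrite mulmxDr mulmx1 mulmxBl mul1mx sq0 subr0 subrK.
by rewrite mulmxBr mulmx1 mulmxDl mul1mx sq0 addr0 addrK.
Qed.

(** As [R *m C = 1], the map sending [x] to [1 + C (x - 1) R] is multiplicative. Scalars are kept as
    1 x 1 matrices, so that they multiply rows and columns by [*m]. *)
Lemma inverse_scaling C R (a b : 'M[A]_1) :
  R *m C = 1%:M -> a *m b = 1%:M -> b *m a = 1%:M ->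
  inverse_of_mx (1%:M + C *m (b - 1%:M) *m R) (1%:M + C *m (a - 1%:M) *m R).
Proof.
move=> RC1.
have half (x y : 'M[A]_1) : x *m y = 1%:M ->
    (1%:M + C *m (x - 1%:M) *m R) *m (1%:M + C *m (y - 1%:M) *m R) = 1%:M.
  move=> xy1; rewrite mulmxDl mul1mx mulmxDr mulmx1.
  have -> : C *m (x - 1%:M) *m R *m (C *m (y - 1%:M) *m R)
      = C *m ((x - 1%:M) *m (y - 1%:M)) *m R.
    by rewrite -!mulmxA (mulmxA R C) RC1 mul1mx.
  rewrite -addrA -!mulmxDl -!mulmxDr mulmxBr mulmxBl xy1 mul1mx mulmx1.
  (* The middle factor is [x y - 1], expanded, with [x y = 1] already substituted. *)
  have -> : y - 1%:M + (x - 1%:M + (1%:M - y - (x - 1%:M))) = 0.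
    by rewrite [x - 1%:M + _]addrC subrK addrA subrK subrr.
  by rewrite mulmx0 mul0mx addr0.
by move=> ab1 ba1; split; apply: half.
Qed.

Variable i : 'I_n.
Let e : 'cV[A]_n := delta_mx i 0.
Let f : 'rV[A]_n := delta_mx 0 i.

Let fe : f *m e = 1%:M.
Proof. by rewrite mul_delta_mx; apply/matrixP=> j k; rewrite !mxE !ord1. Qed.

Let ef : e *m f = delta_mx i i. Proof. exact: mul_delta_mx. Qed.

Lemma row_completion_dual R C : R *m C = 1%:M ->
  (exists W, invertible_mx W /\ row i W = R) ->
  exists W V, [/\ inverse_of_mx W V, row i W = R & col i V = C].
Proof.
move=> RC1 [W [[V WV]]]; rewrite rowE -/f => fW.
have fX : f *m (W *m C) = 1%:M by rewrite mulmxA fW.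
have fX0 : f *m (W *m C - e) = 0 by rewrite mulmxBr fX fe subrr.
have inv := inverse_of_mxM (inverse_transvection fX0) WV.
exists ((1%:M - (W *m C - e) *m f) *m W), (V *m (1%:M + (W *m C - e) *m f)).
split=> //.
  by rewrite rowE -/f mulmxA mulmxBr mulmx1 mulmxA fX0 mul0mx subr0.
(* The inverse transvection sends [e] back to [W C], and [V] then sends it to [C]. *)
rewrite colE -/e -mulmxA mulmxDl mul1mx -(mulmxA _ f) fe mulmx1 addrC subrK.
by rewrite mulmxA WV.2 mul1mx.
Qed.

(** Here [Y = R W] satisfies [Y e = 1], and [1 - e (Y - f)] multiplies [W] on the right, fixing [e]
    and sending [Y] to [f]. The completion of [R] is the inverse of this product. *)
Lemma col_completion_dual R C : R *m C = 1%:M ->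
  (exists W, invertible_mx W /\ col i W = C) ->
  exists W V, [/\ inverse_of_mx W V, row i W = R & col i V = C].
Proof.
move=> RC1 [W [[V WV]]]; rewrite colE -/e => We.
have Ye : R *m W *m e = 1%:M by rewrite -mulmxA We.
have Ye0 : (R *m W - f) *m e = 0 by rewrite mulmxBl Ye fe subrr.
have inv := inverse_of_mxM WV (inverse_transvection Ye0).
exists ((1%:M + e *m (R *m W - f)) *m V), (W *m (1%:M - e *m (R *m W - f))).
split; first exact: inverse_of_mx_sym inv.
  rewrite rowE -/f mulmxA mulmxDr mulmx1 mulmxA fe mul1mx addrC subrK.
  by rewrite -mulmxA WV.1 mulmx1.
by rewrite colE -/e -mulmxA mulmxBl mul1mx -(mulmxA e) Ye0 mulmx0 subr0.
Qed.

(** With [R = f W] and [C = V e], conjugating [C R] by [W] cancels both inverse pairs. *)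
Lemma dual_completion_similar R C :
  (exists W V, [/\ inverse_of_mx W V, row i W = R & col i V = C]) ->
  similar_mx (C *m R) (delta_mx i i).
Proof.
move=> [W [V [WV <- <-]]]; exists W, V; split=> //.
rewrite rowE colE -/e -/f -ef !mulmxA WV.1 mul1mx.
by rewrite -!mulmxA WV.1 mulmx1.
Qed.

Lemma similar_row_completion R C : R *m C = 1%:M ->
  similar_mx (C *m R) (delta_mx i i) ->
  exists W, invertible_mx W /\ row i W = R.
Proof.
move=> RC1 [W [V [WV]]]; rewrite -ef mulmxA -mulmxA => xy.
have yx : R *m V *m (W *m C) = 1%:M.
  by rewrite mulmxA -(mulmxA R) WV.2 mulmx1.
(* These are the [i]-th entries of [W C] and [R V]. Both [a b = 1] and [b a = 1] follow from
   [W C R V = e f] together with [R V W C = 1]. *)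
pose a := f *m (W *m C); pose b := R *m V *m e.
have ab : a *m b = 1%:M.
  by rewrite /a /b -(mulmxA f) [X in f *m X]mulmxA xy -mulmxA fe mulmx1.
have ba : b *m a = 1%:M.
  rewrite /a /b -(mulmxA _ e) [e *m _]mulmxA -xy -(mulmxA (W *m C)) yx.
  by rewrite mulmx1.
have bf : b *m f = R *m V.
  by rewrite /b -(mulmxA _ e) -xy mulmxA yx mul1mx.
have inv := inverse_of_mxM (inverse_scaling fe ab ba) WV.
(* Row [i] of this product is [b f W], which is [R V W = R]. *)
exists ((1%:M + e *m (b - 1%:M) *m f) *m W); split; first by eexists; exact: inv.
rewrite rowE -/f mulmxA mulmxDr mulmx1 !mulmxA fe mul1mx mulmxBl mul1mx.
by rewrite addrC subrK bf -mulmxA WV.2 mulmx1.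
Qed.

End MatrixCompletion.

Theorem theorem2p1 (K : numFieldType) (A : banachAlgType K) (n : nat)
    (hn : (2 <= n)%N) (R : 'rV[A]_n) (C : 'cV[A]_n) (hRC : R *m C = 1%:M) :
  [<-> exists W : 'M[A]_n, invertible_mx W /\ row (first_ord hn) W = R;
       exists W : 'M[A]_n, invertible_mx W /\ col (first_ord hn) W = C;
       exists W V : 'M[A]_n, [/\ inverse_of_mx W V,
         row (first_ord hn) W = R & col (first_ord hn) V = C];
       similar_mx (C *m R) (delta_mx (first_ord hn) (first_ord hn))].
Proof.
tfae.
(* The inverse of the completion of [R] is the matrix with first column [C]. *)
- move/(row_completion_dual hRC) => [W [V [WV _ VC]]].
  by exists V; split=> //; exists W; exact: inverse_of_mx_sym.
- exact: col_completion_dual.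
- exact: dual_completion_similar.
- exact: similar_row_completion.
Qed.
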